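(* Let $\mathbb X=\mathbb X_1\oplus\mathbb X_2$ be a Hilbert space, let $\mathcal A:D(\mathcal A)\subseteq\mathbb X\to\mathbb X$ be a dissipative linear operator, and let $$\mathcal E=\begin{bmatrix}\mathcal E_1&0\\0&0\end{bmatrix},\qquad \mathcal Q=\begin{bmatrix}\mathcal Q_1&0\\0&\mathcal Q_2\end{bmatrix}$$ with respect to $\mathbb X_1\oplus\mathbb X_2$, where $\mathcal E_1,\mathcal Q_1$ (on $\mathbb X_1$) and $\mathcal Q_2$ (on $\mathbb X_2$) are bounded and boundedly invertible and $\mathcal E_1^*\mathcal Q_1$ is coercive. Then the following are equivalent. (i) The pair $(\mathcal E,\mathcal A\mathcal Q)$ is regular. (ii) For all $s\in\mathbb C^+$ the operator $s\mathcal E-\mathcal A\mathcal Q$ is boundedly invertible. (iii) There exists an $s\in\mathbb C^+$ such that $s\mathcal E-\mathcal A\mathcal Q$ is boundedly invertible. (iv) $\mathcal A$ is maximally dissipative, and there exists $m_1>0$ such that $$\left\|\begin{bmatrix}\mathcal E\\ \mathcal A\mathcal Q\end{bmatrix}x\right\|\ge m_1\|x\|\quad\text{for all } x\in\mathbb X \text{ with } \mathcal Qx\in D(\mathcal A).$$ (v) $\mathcal A$ is maximally dissipative, and there exists $m_2>0$ such that $$\left\|\begin{bmatrix}\mathcal E\mathcal Q^{-1}\\ \mathcal A\end{bmatrix}x\right\|\ge m_2\|x\|\quad\text{for all } x\in D(\mathcal A).$$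
   Context: Hilbert spaces are complex; $\mathbb C^+=\{s\in\mathbb C:\operatorname{Re}s>0\}$. A linear operator $\mathcal A:D(\mathcal A)\subseteq\mathbb X\to\mathbb X$ is dissipative if $\operatorname{Re}\langle\mathcal Ax,x\rangle\le0$ for all $x\in D(\mathcal A)$; it is maximally dissipative if it is dissipative and $sI-\mathcal A$ is surjective for all $s>0$. A bounded operator $T$ is coercive if it is self-adjoint and there is $\kappa>0$ with $\langle Tx,x\rangle\ge\kappa\|x\|^2$ for all $x$. The operator $s\mathcal E-\mathcal A\mathcal Q$ has domain $\{x\in\mathbb X:\mathcal Qx\in D(\mathcal A)\}$. A (possibly unbounded) operator is boundedly invertible if it is a bijection from its domain onto the whole space with bounded inverse. The pair $(\mathcal E,\mathcal A\mathcal Q)$ is called regular if there exists $s\in\mathbb C^+$ such that $s\mathcal E-\mathcal A\mathcal Q$ is boundedly invertible. *)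

(* Defs.v *)
From HB Require Import structures.
From mathcomp Require Import all_boot all_order all_algebra.
From mathcomp Require Import ring lra complex.
From mathcomp Require Import all_classical all_reals interval_inference topology normedtype.

Set Implicit Arguments.
Unset Strict Implicit.
Unset Printing Implicit Defensive.

Import Order.TTheory GRing.Theory Num.Theory.
Import numFieldNormedType.Exports.

Local Open Scope classical_set_scope.
Local Open Scope ring_scope.

(* Complex Hilbert spaces: complete normed spaces over R[i] whose norm comes from
   an inner product. The inner product is linear in its first argument and
   conjugate-linear in the second one. *)
HB.mixin Record isHilbert (R : realType) H of CompleteNormedModule R[i] H := {
  inner : {dot H for (@Num.conj R[i])};
  norm_inner : forall x : H, `|x| ^+ 2 = inner x x
}.

#[short(type="hilbertType")]
HB.structure Definition Hilbert (R : realType) :=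
  {H of CompleteNormedModule R[i] H & isHilbert R H}.

Notation "''[' x , y ]" := (inner x y) : ring_scope.

(* The orthogonal sum of two Hilbert spaces. This alias of the product type
   carries the norm sqrt(|x.1|^2 + |x.2|^2) instead of the max norm with which
   the library equips products. *)
Definition hsum (R : realType) (X1 X2 : hilbertType R) : Type := (X1 * X2)%type.

Section HilbertSum.
Variables (R : realType) (X1 X2 : hilbertType R).

HB.instance Definition _ :=
  GRing.Lmodule.copy (hsum X1 X2) (X1 * X2)%type.

Definition hsum_norm (x : hsum X1 X2) : R[i] :=
  sqrtC (`|x.1| ^+ 2 + `|x.2| ^+ 2).

Lemma hsum_norm_ge0 x : 0 <= hsum_norm x.
Proof. by rewrite sqrtC_ge0 addr_ge0 // exprn_ge0. Qed.

Lemma sqr_hsum_norm x : hsum_norm x ^+ 2 = `|x.1| ^+ 2 + `|x.2| ^+ 2.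
Proof. exact: sqrtCK. Qed.

Lemma hsum_ler_normD x y : hsum_norm (x + y) <= hsum_norm x + hsum_norm y.
Proof.
have s0 := hsum_norm_ge0 x; have t0 := hsum_norm_ge0 y.
rewrite -(ler_pXn2r (n := 2)) ?nnegrE ?addr_ge0 ?hsum_norm_ge0 //.
rewrite sqrrD !sqr_hsum_norm /=.
set a := `|x.1|; set b := `|x.2|; set c := `|y.1|; set d := `|y.2|.
have [a0 b0 c0 d0] : [/\ 0 <= a, 0 <= b, 0 <= c & 0 <= d] by rewrite !normr_ge0.
apply: (@le_trans _ _ ((a + c) ^+ 2 + (b + d) ^+ 2)).
  by rewrite lerD // ler_pXn2r ?nnegrE ?addr_ge0 // ler_normD.
have st : a * c + b * d <= hsum_norm x * hsum_norm y.
  rewrite -(ler_pXn2r (n := 2)) ?nnegrE ?addr_ge0 ?mulr_ge0 //.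
  rewrite exprMn !sqr_hsum_norm -/a -/b -/c -/d -subr_ge0.
  have -> : (a ^+ 2 + b ^+ 2) * (c ^+ 2 + d ^+ 2) - (a * c + b * d) ^+ 2 =
    (a * d - b * c) ^+ 2 by ring.
  by rewrite real_exprn_even_ge0 // rpredB // rpredM // ger0_real.
rewrite -subr_ge0.
have -> : a ^+ 2 + b ^+ 2 + hsum_norm x * hsum_norm y *+ 2 + (c ^+ 2 + d ^+ 2) -
   ((a + c) ^+ 2 + (b + d) ^+ 2) =
   (hsum_norm x * hsum_norm y - (a * c + b * d)) *+ 2 by ring.
by rewrite mulrn_wge0 // subr_ge0.
Qed.

Lemma hsum_normrZ (l : R[i]) x : hsum_norm (l *: x) = `|l| * hsum_norm x.
Proof.
rewrite /hsum_norm /= !normrZ !exprMn -mulrDr.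
by rewrite rootCMl ?exprn_ge0 // sqrCK.
Qed.

Lemma hsum_normr0_eq0 x : hsum_norm x = 0 -> x = 0.
Proof.
move=> /(congr1 (fun z => z ^+ 2)); rewrite sqr_hsum_norm expr0n /= => /eqP.
rewrite paddr_eq0 ?exprn_ge0 // !sqrf_eq0 !normr_eq0 => /andP[/eqP x1 /eqP x2].
by case: x x1 x2 => ? ? /= -> ->.
Qed.

HB.instance Definition _ := Lmodule_isNormed.Build R[i] (hsum X1 X2)
  hsum_ler_normD hsum_normrZ hsum_normr0_eq0.

Lemma hsum_normE (x : hsum X1 X2) : `|x| = sqrtC (`|x.1| ^+ 2 + `|x.2| ^+ 2).
Proof. by []. Qed.

Lemma hsum_le_fst (x : hsum X1 X2) : `|x.1| <= `|x|.
Proof.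
rewrite -(ler_pXn2r (n := 2)) ?nnegrE ?normr_ge0 //.
by rewrite hsum_normE sqrtCK lerDl exprn_ge0.
Qed.

Lemma hsum_le_snd (x : hsum X1 X2) : `|x.2| <= `|x|.
Proof.
rewrite -(ler_pXn2r (n := 2)) ?nnegrE ?normr_ge0 //.
by rewrite hsum_normE sqrtCK lerDr exprn_ge0.
Qed.

Lemma hsum_le_add (x : hsum X1 X2) : `|x| <= `|x.1| + `|x.2|.
Proof.
rewrite -(ler_pXn2r (n := 2)) ?nnegrE ?addr_ge0 ?normr_ge0 //.
rewrite hsum_normE sqrtCK sqrrD -addrA lerD2l lerDr.
by rewrite mulrn_wge0 // mulr_ge0.
Qed.

Lemma hsum_complete (F : set_system (hsum X1 X2)) :
  ProperFilter F -> cauchy F -> cvg F.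
Proof.
move=> FF /cauchyP cF.
have c1 : cauchy ((fst : hsum X1 X2 -> X1) @ F).
  apply/cauchyP => e e0; have [x Fx] := cF e e0; exists x.1.
  apply: (@filterS _ F _ _ _ _ Fx) => y; rewrite -!ball_normE /=.
  by apply: le_lt_trans; apply: (hsum_le_fst (x - y)).
have c2 : cauchy ((snd : hsum X1 X2 -> X2) @ F).
  apply/cauchyP => e e0; have [x Fx] := cF e e0; exists x.2.
  apply: (@filterS _ F _ _ _ _ Fx) => y; rewrite -!ball_normE /=.
  by apply: le_lt_trans; apply: (hsum_le_snd (x - y)).
have [a Fa] : exists a : X1, (fst : hsum X1 X2 -> X1) @ F --> a.
  by apply/cvg_ex; exact: cauchy_cvg c1.
have [b Fb] : exists b : X2, (snd : hsum X1 X2 -> X2) @ F --> b.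
  by apply/cvg_ex; exact: cauchy_cvg c2.
apply/cvg_ex; exists ((a, b) : hsum X1 X2).
apply/cvgrPdist_lt => e e0; have e20 : 0 < e / 2 by rewrite divr_gt0.
near=> y; apply: (le_lt_trans (hsum_le_add _)); rewrite [e]splitr ltrD //=.
  by near: y; move/cvgrPdist_lt : Fa; apply.
by near: y; move/cvgrPdist_lt : Fb; apply.
Unshelve. all: by end_near. Qed.

HB.instance Definition _ := Uniform_isComplete.Build (hsum X1 X2) hsum_complete.
Definition hsum_inner (x y : hsum X1 X2) : R[i] := '[x.1, y.1] + '[x.2, y.2].

Lemma hsum_inner_bilinear : bilinear_for
   ( *%R : GRing.Scale.law _ _) ((@Num.conj R[i] \; *%R) : GRing.Scale.law _ _) hsum_inner.
Proof.
split=> u a x y; rewrite /hsum_inner /=.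
  by rewrite !linearDl !linearZl_LR /= mulrDr addrACA.
by rewrite !linearDr !linearZr_LR /= mulrDr addrACA.
Qed.

HB.instance Definition _ := @bilinear_isBilinear.Build R[i] _ _ _ _ _
  hsum_inner hsum_inner_bilinear.

Lemma hsum_inner_herm (x y : hsum X1 X2) :
  hsum_inner x y = (-1) ^+ false * Num.conj (hsum_inner y x).
Proof.
by rewrite expr0 mul1r /hsum_inner rmorphD /= (hermC inner x.1) (hermC inner x.2) !expr0 !mul1r.
Qed.

HB.instance Definition _ :=
  @isHermitianSesquilinear.Build R[i] (hsum X1 X2) false (@Num.conj R[i])
    hsum_inner hsum_inner_herm.

Lemma hsum_norm_inner (x : hsum X1 X2) : `|x| ^+ 2 = hsum_inner x x.
Proof. by rewrite hsum_normE sqrtCK !norm_inner. Qed.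

Lemma hsum_inner_gt0 (x : hsum X1 X2) : x != 0 -> 0 < hsum_inner x x.
Proof. by move=> x0; rewrite -hsum_norm_inner exprn_gt0 // normr_gt0. Qed.

HB.instance Definition _ :=
  @isDotProduct.Build R[i] (hsum X1 X2) hsum_inner hsum_inner_gt0.

HB.instance Definition _ := isHilbert.Build R (hsum X1 X2) hsum_norm_inner.

End HilbertSum.
Section Riesz.
Variables (R : realType) (H : hilbertType R).
Implicit Types x y : H.

Let ltr0c (x : R) : (0 < x%:C%C :> R[i]) = (0 < x).
Proof. exact: (ltcR 0 x). Qed.

Let near_inv (e : R) : 0 < e -> \forall k \near \oo, k.+1%:R^-1 < e.
Proof. by move=> /posnumP[{}e]; exact: near_infty_natSinv_lt. Qed.

Let n x : R := complex.Re `|x|.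

Let nE x : (n x)%:C%C = `|x|.
Proof. by rewrite RRe_real // ger0_real. Qed.

Let n_ge0 x : 0 <= n x.
Proof. by rewrite -lecR nE normr_ge0. Qed.

Let n_sqr x : ((n x) ^+ 2)%:C%C = '[x, x].
Proof. by rewrite rmorphXn /= nE norm_inner. Qed.

Let nZ (r : R) x : 0 <= r -> n (r%:C%C *: x) = r * n x.
Proof.
move=> r0; apply: complexI.
by rewrite nE normrZ rmorphM /= nE ger0_norm ?ler0c.
Qed.

Let n_par x y : n (x - y) ^+ 2 + n (x + y) ^+ 2 = 2 * n x ^+ 2 + 2 * n y ^+ 2.
Proof.
have e : (2 * n x ^+ 2 + 2 * n y ^+ 2)%:C%C = 2 * '[x, x] + 2 * '[y, y] :> R[i].
  by rewrite rmorphD -!n_sqr; congr (_ + _); rewrite rmorphM /= rmorph_nat.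
apply: complexI; rewrite e rmorphD /= !n_sqr (dnormB inner x y) (dnormD inner x y) /=.
ring.
Qed.

Let n_triangle x y : n (x + y) <= n x + n y.
Proof. by rewrite -lecR rmorphD /= !nE ler_normD. Qed.

Lemma riesz (f : H -> R[i]) : linear_for *%R f ->
  (exists M, forall x, `|f x| <= M * `|x|) -> exists y, forall x, f x = '[x, y].
Proof.
move=> flin [M fM].
pose g : {linear H -> R[i] | *%R} := HB.pack f (GRing.isLinear.Build _ _ _ _ f flin).
have fZ a x : f (a *: x) = a * f x by exact: (linearZ_LR g a x).
have fD x y : f (x + y) = f x + f y by exact: (linearD g x y).
have fB x y : f (x - y) = f x - f y by exact: (linearB g x y).
have f00 : f 0 = 0 by exact: (linear0 g).
have [f0|] := pselect (forall x, f x = 0).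
  by exists 0 => x; rewrite f0 linear0r.
move=> /existsNP[x0 /eqP fx0].
have x1 : f ((f x0)^-1 *: x0) = 1.
  by rewrite fZ mulVf.
pose C := [set x | f x = 1].
pose S := [set n x | x in C].
have S_inf : has_inf S.
  split; first by exists (n ((f x0)^-1 *: x0)), ((f x0)^-1 *: x0).
  by exists 0 => _ [x _ <-].
pose d := inf S.
have dn x : C x -> d <= n x.
  by move=> Cx; apply: ge_inf; [exact: S_inf.2|exists x].
have d0 : 0 <= d by apply: lb_le_inf; [exact: S_inf.1|move=> _ [x _ <-]].
have /choice[u uP] : forall k : nat, exists x, C x /\ n x < d + k.+1%:R^-1.
  move=> k; have k0 : 0 < (k.+1%:R^-1 : R) by rewrite invr_gt0.
  by have [_ [x Cx <-] xd] := inf_adherent k0 S_inf; exists x.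
have uB k m : (k <= m)%N -> n (u k - u m) ^+ 2 <= (8 * d + 4) * k.+1%:R^-1.
  move=> km; have [Ck uk] := uP k; have [Cm um] := uP m.
  set e : R := k.+1%:R^-1 in uk *.
  have e0 : 0 <= e by rewrite invr_ge0.
  have e1 : e <= 1 by rewrite invf_le1 ?ler1n.
  have {}um : n (u m) < d + e.
    by apply: (lt_le_trans um); rewrite lerD2l lef_pV2 ?posrE // ler_nat.
  have h : 2 * d <= n (u k + u m).
    have -> : n (u k + u m) = 2 * n ((2^-1)%:C%C *: (u k + u m)).
      by rewrite nZ ?invr_ge0 // mulrA divff ?mul1r ?pnatr_eq0.
    rewrite ler_pM2l // dn // /C /=.
    rewrite fZ fD [f (u k)]Ck [f (u m)]Cm.
    by rewrite fmorphV rmorph_nat mulVf ?pnatr_eq0.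
  have /= p := n_par (u k) (u m).
  have := n_ge0 (u k); have := n_ge0 (u m); have := n_ge0 (u k + u m).
  nra.
have cu : cauchy (u @ \oo).
  apply/cauchyP => e e0.
  have er : e = (complex.Re e)%:C%C by rewrite RRe_real // gtr0_real.
  rewrite er ltr0c in e0 *; set r := complex.Re e in e0 *.
  pose b := r ^+ 2 / (8 * d + 4).
  have b0 : 0 < b by rewrite divr_gt0 ?exprn_gt0 //; lra.
  have [N _ /(_ N (leqnn N)) /= NP] := near_inv b0.
  exists (u N); exists N => // m /= Nm; rewrite -ball_normE /= -nE ltcR.
  rewrite -(ltr_pXn2r (n := 2)) ?nnegrE ?n_ge0 ?(ltW e0) //.
  apply: (le_lt_trans (uB N m Nm)).
  by rewrite mulrC -ltr_pdivlMr //; lra.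
have [a ua] : exists a : H, u @ \oo --> a by apply/cvg_ex; exact: cauchy_cvg cu.
have ua' (e : R) : 0 < e -> \forall k \near \oo, n (a - u k) < e.
  move=> e0; have e0' : 0 < e%:C%C by rewrite ltr0c.
  move/cvgrPdist_lt : ua => /(_ _ e0'); apply: filterS => k.
  by rewrite -nE ltcR.
have na : n a <= d.
  apply/ler_addgt0Pr => e e0.
  near \oo => k.
  have h1 : n (a - u k) < e / 2 by near: k; apply: ua'; rewrite divr_gt0.
  have h2 : k.+1%:R^-1 < e / 2.
    by near: k; apply: near_inv; rewrite divr_gt0.
  have := n_triangle (a - u k) (u k); rewrite subrK.
  have {h2} : n (u k) < d + e / 2.
    by apply: (lt_trans (uP k).2); rewrite ltrD2l.
  lra.
have fa : f a = 1.
  apply/eqP; rewrite -subr_eq0 -normr_eq0; apply/eqP/le_anti.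
  rewrite normr_ge0 andbT; set z : R[i] := `|_|.
  have zr : z = (complex.Re z)%:C%C by rewrite RRe_real // ger0_real // normr_ge0.
  rewrite zr lecR; apply/ler_addgt0Pr => e e0; rewrite add0r -lecR -zr.
  pose K := complex.Re `|M| + 1.
  have M0 : 0 <= complex.Re `|M|.
    by rewrite -lecR RRe_real ?ger0_real ?normr_ge0.
  have Kpos : 0 < K by rewrite /K; lra.
  near \oo => k.
  have h1 : n (a - u k) < e / K by near: k; apply: ua'; rewrite divr_gt0.
  have -> : z = `|f (a - u k)|.
    by rewrite /z fB [f (u k)](uP k).1.
  apply: (le_trans (fM _)).
  set w := a - u k in h1 *.
  have Mw : 0 <= M * `|w| := le_trans (normr_ge0 _) (fM w).
  rewrite -(ger0_norm Mw) normrM normr_id -nE.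
  have -> : `|M| = (complex.Re `|M|)%:C%C by rewrite RRe_real // ger0_real // normr_ge0.
  rewrite -rmorphM lecR; apply: (@le_trans _ _ (K * n w)).
    by rewrite ler_wpM2r // /K lerDl.
  by rewrite mulrC -ler_pdivlMr // ltW.
have orth v : f v = 0 -> '[v, a] = 0.
  move=> fv; have [->|v0] := eqVneq v 0; first by rewrite linear0l.
  have vv : 0 < '[v, v] by rewrite dnorm_gt0.
  pose t := - '[a, v] / '[v, v].
  have Ct : C (a + t *: v).
    by rewrite /C /= fD fZ fv mulr0 addr0.
  have := le_trans na (dn _ Ct); rewrite -(ler_pXn2r (n := 2)) ?nnegrE //.
  rewrite -lecR !n_sqr (dnormD inner a) (dnormZ inner) linearZr_LR /=.
  have wC : '[v, v]^* = '[v, v] by rewrite geC0_conj // ltW.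
  have -> : `|t| ^+ 2 * '[v, v] = `|'[a, v]| ^+ 2 / '[v, v].
    rewrite /t normrM normrN exprMn normfV (ger0_norm (ltW vv)).
    by rewrite -mulrA; congr (_ * _); rewrite expr2 -mulrA mulVf ?mulr1 ?gt_eqF.
  have -> : t^* * '[a, v] = - (`|'[a, v]| ^+ 2 / '[v, v]).
    rewrite /t rmorphM rmorphN fmorphV /= wC normCK; ring.
  have p0 : 0 <= `|'[a, v]| ^+ 2 / '[v, v].
    by rewrite divr_ge0 ?exprn_ge0 // ltW.
  rewrite rmorphN /= geC0_conj // addrA addrK lerBrDl gerDr => p1.
  have /eqP : `|'[a, v]| ^+ 2 / '[v, v] = 0 by apply/le_anti; rewrite p1.
  rewrite mulf_eq0 invr_eq0 (gt_eqF vv) orbF sqrf_eq0 normr_eq0 => /eqP av.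
  have -> : '[v, a] = '[a, v]^* by rewrite hermC expr0 mul1r.
  by rewrite (_ : '[a, v] = 0) ?rmorph0 //; exact: av.
have aa : '[a, a] != 0.
  rewrite dnorm_eq0; apply: contra_eq_neq fa => ->.
  by rewrite f00 eq_sym oner_eq0.
exists ('[a, a]^-1 *: a) => x.
have := orth (x - f x *: a); rewrite fB fZ fa mulr1 subrr.
move=> /(_ erefl); rewrite linearBl linearZl_LR /= => /eqP.
rewrite subr_eq0 => /eqP xa.
have -> : '[x, '[a, a]^-1 *: a] = ('[a, a]^-1)^* * '[x, a] by exact: linearZr_LR.
rewrite xa geC0_conj ?invr_ge0 ?dnorm_ge0 //.
by rewrite mulrCA mulVf // mulr1.
Unshelve. all: by end_near. Qed.

End Riesz.

Section Operators.
Variable R : realType.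
Implicit Types X Y Z : hilbertType R.

Lemma cauchy_schwarz X (x y : X) : `|'[x, y]| <= `|x| * `|y|.
Proof.
have [->|y0] := eqVneq y 0; first by rewrite linear0r !normr0 mulr0.
have yy : 0 < '[y, y] by rewrite dnorm_gt0.
have yyC : '[y, y]^* = '[y, y] by rewrite geC0_conj // ltW.
pose t := - '[x, y] / '[y, y].
have : 0 <= '[x + t *: y, x + t *: y] by rewrite dnorm_ge0.
rewrite (dnormD inner x) (dnormZ inner).
have -> : '[x, t *: y] = t^* * '[x, y] by exact: linearZr_LR.
have -> : `|t| ^+ 2 * '[y, y] = `|'[x, y]| ^+ 2 / '[y, y].
  rewrite /t normrM normrN exprMn normfV (ger0_norm (ltW yy)).
  by rewrite -mulrA; congr (_ * _); rewrite expr2 -mulrA mulVf ?mulr1 ?gt_eqF.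
have -> : t^* * '[x, y] = - (`|'[x, y]| ^+ 2 / '[y, y]).
  by rewrite /t rmorphM rmorphN fmorphV /= yyC normCK; ring.
have p0 : 0 <= `|'[x, y]| ^+ 2 / '[y, y].
  by rewrite divr_ge0 ?exprn_ge0 // ltW.
rewrite rmorphN /= geC0_conj // addrA addrK subr_ge0 ler_pdivrMr // => h.
rewrite -(ler_pXn2r (n := 2)) ?nnegrE ?mulr_ge0 ?normr_ge0 //.
by rewrite exprMn !norm_inner.
Qed.

Definition bounded_map X Y (f : X -> Y) : Prop :=
  exists M : R[i], forall x, `|f x| <= M * `|x|.

Record bounded_operator X Y := BoundedOperator {
  bop :> {linear X -> Y};
  bopP : bounded_map bop
}.

Lemma bounded_ge0 X Y (f : X -> Y) : bounded_map f ->
  exists2 M : R[i], 0 <= M & forall x, `|f x| <= M * `|x|.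
Proof.
move=> [M fM]; exists `|M| => // x.
have Mx : 0 <= M * `|x| := le_trans (normr_ge0 _) (fM x).
by rewrite -[`|x|]normr_id -normrM ger0_norm.
Qed.

Lemma inner_injr X (y z : X) : (forall x, '[x, y] = '[x, z]) -> y = z.
Proof.
move=> yz; apply/eqP; rewrite -subr_eq0 -(dnorm_eq0 inner).
have -> : '[y - z, y - z] = '[y - z, y] - '[y - z, z] by exact: linearBr.
by rewrite yz subrr.
Qed.

Lemma adjoint_exists X Y (T : bounded_operator X Y) :
  exists S : bounded_operator Y X, forall x y, '[T x, y] = '[x, S y].
Proof.
have [M M0 TM] := bounded_ge0 (bopP T).
have /choice[S TS] : forall y, exists z, forall x, '[T x, y] = '[x, z].
  move=> y; apply: (@riesz _ _ (fun x => '[T x, y])).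
    by move=> a u v; rewrite linearP linearDl linearZl_LR.
  exists (M * `|y|) => x; apply: (le_trans (cauchy_schwarz _ _)).
  by rewrite mulrAC ler_wpM2r.
have S_lin : linear S.
  move=> a u v; apply: inner_injr => x.
  have -> : '[x, a *: S u + S v] = a^* * '[x, S u] + '[x, S v].
    exact: (linearPr inner).
  rewrite -!TS; exact: (linearPr inner).
pose g : {linear Y -> X} := HB.pack S (GRing.isLinear.Build _ _ _ _ S S_lin).
have g_bd : bounded_map g.
  exists M => y; have [->|Sy0] := eqVneq (g y) 0.
    by rewrite normr0 mulr_ge0.
  have Sy : 0 < `|g y| by rewrite normr_gt0.
  rewrite -(ler_pM2r Sy) -expr2 norm_inner -[in leLHS]TS.
  apply: (le_trans (real_ler_norm _)); first by rewrite TS ger0_real ?dnorm_ge0.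
  apply: (le_trans (cauchy_schwarz _ _)).
  by rewrite mulrAC ler_wpM2r.
by exists (BoundedOperator g_bd).
Qed.

(* Total by the Riesz representation theorem; the adjoint is unique by
   inner_injr, so the choice made here is immaterial. *)
Definition adjoint X Y (T : bounded_operator X Y) : bounded_operator Y X :=
  sval (cid (adjoint_exists T)).

Lemma adjointP X Y (T : bounded_operator X Y) x y :
  '[T x, y] = '[x, adjoint T y].
Proof. by rewrite /adjoint; case: cid. Qed.

Lemma bop0_subproof X Y : bounded_map (\0 : {linear X -> Y}).
Proof. by exists 0 => x /=; rewrite normr0 mul0r. Qed.
Definition bop0 X Y := BoundedOperator (@bop0_subproof X Y).

Lemma bop_comp_subproof X Y Z (S : bounded_operator Y Z)
  (T : bounded_operator X Y) : bounded_map (S \o T : {linear X -> Z}).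
Proof.
have [M M0 SM] := bounded_ge0 (bopP S); have [N N0 TN] := bounded_ge0 (bopP T).
exists (M * N) => x /=; apply: (le_trans (SM _)).
by rewrite -mulrA ler_wpM2l.
Qed.
Definition bop_comp X Y Z (S : bounded_operator Y Z)
    (T : bounded_operator X Y) : bounded_operator X Z :=
  BoundedOperator (bop_comp_subproof S T).

Section BlockDiag.
Context X1 X2 (T1 : bounded_operator X1 X1) (T2 : bounded_operator X2 X2).

Let diag (x : hsum X1 X2) : hsum X1 X2 := (T1 x.1, T2 x.2).

Let diag_linear : linear diag.
Proof. by move=> a x y; rewrite /diag /= !linearP. Qed.

HB.instance Definition _ :=
  GRing.isLinear.Build R[i] (hsum X1 X2) (hsum X1 X2) _ diag diag_linear.

Let diag_bounded : bounded_map diag.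
Proof.
have [M M0 TM] := bounded_ge0 (bopP T1).
have [N N0 TN] := bounded_ge0 (bopP T2).
exists (M + N) => x; apply: (le_trans (hsum_le_add _)).
rewrite mulrDl lerD //=.
  by apply: (le_trans (TM _)); rewrite ler_wpM2l // hsum_le_fst.
by apply: (le_trans (TN _)); rewrite ler_wpM2l // hsum_le_snd.
Qed.

Definition block_diag : bounded_operator (hsum X1 X2) (hsum X1 X2) :=
  @BoundedOperator _ _ diag diag_bounded.

End BlockDiag.

(* A possibly unbounded linear operator T : D(T) -> Y, with D(T) a linear
   subspace of X that need not be dense; op_fun is a total function whose values
   outside dom are junk. *)
Record operator X Y := Operator {
  dom : set X;
  op_fun :> X -> Y;
  dom0 : dom 0;
  dom_lin : forall (a : R[i]) x y, dom x -> dom y -> dom (a *: x + y);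
  op_lin : forall (a : R[i]) x y, dom x -> dom y ->
    op_fun (a *: x + y) = a *: op_fun x + op_fun y
}.

Definition total_op X Y (T : bounded_operator X Y) : operator X Y :=
  @Operator X Y setT T I (fun _ _ _ _ _ => I) (fun a x y _ _ => linearP T a x y).

(* A Q with its natural domain {x | Q x \in D(A)}. *)
Section OpComp.
Context X Y Z (A : operator Y Z) (Q : bounded_operator X Y).

Let D : set X := Q @^-1` dom A.

Let D0 : D 0. Proof. by rewrite /D /preimage /= linear0; exact: dom0. Qed.

Let D_lin (a : R[i]) x y : D x -> D y -> D (a *: x + y).
Proof. by rewrite /D /preimage /= linearP; exact: dom_lin. Qed.

Let AQ_lin (a : R[i]) x y : D x -> D y ->
  A (Q (a *: x + y)) = a *: A (Q x) + A (Q y).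
Proof. by move=> Dx Dy; rewrite linearP op_lin. Qed.

Definition op_comp : operator X Z := Operator D0 D_lin AQ_lin.

End OpComp.

(* s E - B, with the domain of B. *)
Section Pencil.
Context X Y (s : R[i]) (E : bounded_operator X Y) (B : operator X Y).

Let pencil_lin (a : R[i]) x y : dom B x -> dom B y ->
  s *: E (a *: x + y) - B (a *: x + y) =
  a *: (s *: E x - B x) + (s *: E y - B y).
Proof.
move=> Bx By; rewrite op_lin // linearP scalerDr scalerBr !scalerA.
by rewrite (mulrC a) opprD addrACA.
Qed.

Definition pencil : operator X Y :=
  @Operator X Y (dom B) (fun x => s *: E x - B x)
    (@dom0 _ _ B) (@dom_lin _ _ B) pencil_lin.

End Pencil.

(* The inverse map Y -> D(T) when T is a bijection from its domain
   onto Y; junk otherwise. *)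
Definition inv_op X Y (T : operator X Y) : Y -> X :=
  'pinv_(fun=> 0) (dom T) T.

Definition boundedly_invertible X Y (T : operator X Y) : Prop :=
  set_bij (dom T) [set: Y] T /\ bounded_map (inv_op T).

Definition regular X Y (E : bounded_operator X Y) (B : operator X Y) : Prop :=
  exists2 s : R[i], 0 < complex.Re s & boundedly_invertible (pencil s E B).

Definition coercive X (T : bounded_operator X X) : Prop :=
  adjoint T =1 T /\
  exists2 k : R, 0 < k & forall x, k%:C%C * `|x| ^+ 2 <= '[T x, x].

Definition dissipative X (A : operator X X) : Prop :=
  forall x, dom A x -> complex.Re '[A x, x] <= 0.

Definition max_dissipative X (A : operator X X) : Prop :=
  dissipative A /\
  forall s : R, 0 < s ->
    set_surj (dom A) [set: X] (fun x => s%:C%C *: x - A x).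

End Operators.

(* Main.v *)
(* Every operator in sight belongs to the family L(a, b) = a E + b Q - A Q.
   Since E1^* Q1 is coercive, <E x, Q x> >= k |E x|^2, and dissipativity gives
     Re a k |E x|^2 + b |Q x|^2 <= |L(a, b) x| |Q x|,
   so |E x|, and b |Q x|, are controlled by L(a, b) x. Along each of the segments
     (s0, 0) -> (s, 0),   (s0, 0) -> (0, l),   (0, 1) -> (1, 0)
   this yields a bound |L(a, b) x| >= c |x| with c uniform on the segment: on the
   first two, the missing control of |x| comes from invertibility at (s0, 0), on
   the third from the lower bound on (E, A Q). A uniform lower bound propagates
   surjectivity from one end of the segment to the other by finitely many
   small perturbations, each solved by the contraction principle. *)
Require Import Defs.
From mathcomp Require Import all_boot all_order all_algebra.
From mathcomp Require Import ring lra complex.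
From mathcomp Require Import all_classical all_reals topology normedtype sequences.

Set Implicit Arguments.
Unset Strict Implicit.
Unset Printing Implicit Defensive.

Import Order.TTheory GRing.Theory Num.Theory.
Import numFieldNormedType.Exports.

Local Open Scope classical_set_scope.
Local Open Scope ring_scope.

(** * Real-valued norms *)

(** The order on R[i] is only partial; real values make linear and nonlinear real arithmetic
    available. *)
Definition rnorm (R : realType) (V : normedModType R[i]) (x : V) : R :=
  complex.Re `|x|.

Section RealNorm.
Variables (R : realType) (V : normedModType R[i]).
Implicit Types x y : V.

Lemma rnormE x : (rnorm x)%:C%C = `|x|.
Proof. by rewrite RRe_real // ger0_real. Qed.

Lemma rnorm_ge0 x : 0 <= rnorm x.
Proof. by rewrite -lecR rnormE normr_ge0. Qed.

Lemma ler_rnormD x y : rnorm (x + y) <= rnorm x + rnorm y.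
Proof. by rewrite -lecR rmorphD /= !rnormE ler_normD. Qed.

Lemma rnormN x : rnorm (- x) = rnorm x.
Proof. by rewrite /rnorm normrN. Qed.

Lemma rnorm_distC x y : rnorm (x - y) = rnorm (y - x).
Proof. by rewrite /rnorm distrC. Qed.

Lemma ler_rnormB x y : rnorm (x - y) <= rnorm x + rnorm y.
Proof. by rewrite -(rnormN y) ler_rnormD. Qed.

Lemma rnormZ (a : R[i]) x : rnorm (a *: x) = complex.Re `|a| * rnorm x.
Proof.
apply: complexI; rewrite rnormE normrZ rmorphM /= rnormE.
by congr (_ * _); rewrite RRe_real // ger0_real.
Qed.

Lemma rnormZr (a : R) x : rnorm (a%:C%C *: x) = `|a| * rnorm x.
Proof. by rewrite rnormZ normc_def /= expr0n addr0 sqrtr_sqr. Qed.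

Lemma rnorm0 : rnorm (0 : V) = 0.
Proof. by rewrite /rnorm normr0. Qed.

Lemma rnorm0_eq0 x : rnorm x = 0 -> x = 0.
Proof. by move=> x0; apply/normr0_eq0; rewrite -rnormE x0. Qed.

End RealNorm.

Lemma ler_rnormM (R : realType) (V W : normedModType R[i]) (c : R) (x : V)
    (y : W) :
  (c%:C%C * `|x| <= `|y|) = (c * rnorm x <= rnorm y).
Proof. by rewrite -!rnormE -rmorphM /= lecR. Qed.

(** * Fixed points and continuation of surjectivity *)

(* banach_fixed_point is stated for normed spaces over a realType only. *)
Lemma rnorm_fixed_point (R : realType) (X : completeNormedModType R[i])
    (f : X -> X) (q : R) :
  0 <= q < 1 -> (forall u v, rnorm (f u - f v) <= q * rnorm (u - v)) ->
  exists p, f p = p.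
Proof.
move=> /andP[q0 q1] fq.
pose u n := iter n f 0; pose C := rnorm (u 1%N - u 0%N) / (1 - q).
have q1' : 0 < 1 - q by rewrite subr_gt0.
have C0 : 0 <= C by rewrite divr_ge0 ?rnorm_ge0 // ltW.
have step n : rnorm (u n.+1 - u n) <= q ^+ n * ((1 - q) * C).
  elim: n => [|n IHn]; first by rewrite mul1r /C mulrCA divff ?mulr1 ?gt_eqF.
  by apply: (le_trans (fq _ _)); rewrite exprS -mulrA ler_wpM2l.
(* Keeping the exact difference of powers lets the induction on [m] close; dropping [q ^+ (n + m)]
   later yields the Cauchy bound. *)
have dist n m : rnorm (u (n + m)%N - u n) <= C * (q ^+ n - q ^+ (n + m)).
  elim: m => [|m IHm]; first by rewrite addn0 !subrr rnorm0 mulr0.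
  have := ler_rnormD (u (n + m).+1 - u (n + m)%N) (u (n + m)%N - u n).
  rewrite addrA subrK addnS exprS => h.
  have := step (n + m)%N; nra.
have qn (e : R) : 0 < e -> \forall n \near \oo, C * q ^+ n < e.
  (* [C] vanishes when [f] fixes 0, so the division is by [C + 1]. *)
  move=> e0; have /cvgrPdist_lt/(_ (e / (C + 1)) _) : (fun n => q ^+ n) @ \oo --> (0 : R).
    by apply: cvg_expr; rewrite ger0_norm.
  have C1 : 0 < C + 1 by lra.
  move=> /(_ (divr_gt0 e0 C1)); apply: filterS => n.
  rewrite sub0r normrN ger0_norm ?exprn_ge0 // ltr_pdivlMr // => h.
  have := exprn_ge0 n q0; nra.
have cu : cauchy (u @ \oo).
  apply/cauchyP => e e0.
  have er : e = (complex.Re e)%:C%C by rewrite RRe_real // gtr0_real.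
  have e0' : 0 < complex.Re e by rewrite -(ltcR 0) -er.
  have [N _ /(_ N (leqnn N)) /= NP] := qn _ e0'.
  exists (u N); exists N => // m /= Nm; rewrite -ball_normE /= -rnormE er ltcR.
  rewrite rnorm_distC -(subnKC Nm); apply: (le_lt_trans (dist _ _)).
  by apply: le_lt_trans NP; rewrite ler_wpM2l // gerBl exprn_ge0.
have [p up] : exists p : X, u @ \oo --> p by apply/cvg_ex; exact: cauchy_cvg cu.
have up' (e : R) : 0 < e -> \forall k \near \oo, rnorm (p - u k) < e.
  move=> e0; have e0' : 0 < e%:C%C by rewrite (ltcR 0).
  move/cvgrPdist_lt : up => /(_ _ e0'); apply: filterS => k.
  by rewrite -rnormE ltcR.
exists p; apply/eqP; rewrite -subr_eq0; apply/eqP/rnorm0_eq0/le_anti.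
rewrite rnorm_ge0 andbT; apply/ler_addgt0Pr => e e0; rewrite add0r.
have [k _ kP] := up' _ (divr_gt0 e0 (ltr0Sn R 1)).
have /= h1 := kP k (leqnn k); have /= h2 := kP k.+1 (leqnSn k).
have := ler_rnormD (f p - u k.+1) (u k.+1 - p); rewrite addrA subrK.
rewrite (rnorm_distC (u k.+1)) => h3.
have := fq p (u k); have := rnorm_ge0 (p - u k).
rewrite -[f (u k)]/(u k.+1); nra.
Qed.

(** Expansion makes a right inverse [G] of [L] Lipschitz with constant 1/c, so [y - P (G z)] is a
    contraction in [z] with factor [d / c]; its fixed point [z] gives the solution [G z]. The
    iteration runs in the complete space [Y], because [D] may fail to be closed. *)
Lemma expansion_perturb_surj (R : realType) (X Y : completeNormedModType R[i])
    (D : set X) (L P : X -> Y) (c d : R) :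
  0 <= d < c ->
  (forall u v, D u -> D v -> c * rnorm (u - v) <= rnorm (L u - L v)) ->
  (forall u v, D u -> D v -> rnorm (P u - P v) <= d * rnorm (u - v)) ->
  set_surj D [set: Y] L -> set_surj D [set: Y] (fun x => L x + P x).
Proof.
move=> /andP[d0 dc] Lc Pd Ls y _; have c0 : 0 < c by apply: le_lt_trans dc.
have /choice[G GP] : forall z, exists x, D x /\ L x = z.
  by move=> z; have [x Dx <-] := Ls z I; exists x.
have [||z zP] := @rnorm_fixed_point R Y (fun z => y - P (G z)) (d / c).
- by rewrite divr_ge0 ?(ltW c0) //= ltr_pdivrMr // mul1r.
- move=> u v; have [Du Lu] := GP u; have [Dv Lv] := GP v.
  rewrite opprB addrC subrKA rnorm_distC (le_trans (Pd _ _ Du Dv)) //.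
  have := Lc _ _ Du Dv; rewrite Lu Lv mulrAC ler_pdivlMr // => h.
  by rewrite -mulrA ler_wpM2l // mulrC.
- have [Dz Lz] := GP z; exists (G z) => //.
  by rewrite Lz -{1}zP subrK.
Qed.

(** Since [c] and [d] do not depend on [t], one step length 1/N serves the whole interval: each
    perturbation has Lipschitz constant at most |d|/N < c. *)
Lemma expansion_continuation (R : realType) (X Y : completeNormedModType R[i])
    (D : set X) (L : R -> X -> Y) (c d : R) :
  0 < c ->
  (forall t u v, 0 <= t <= 1 -> D u -> D v ->
    c * rnorm (u - v) <= rnorm (L t u - L t v)) ->
  (forall s t u v, D u -> D v ->
    rnorm ((L t u - L s u) - (L t v - L s v)) <= d * `|t - s| * rnorm (u - v)) ->
  set_surj D [set: Y] (L 0) -> set_surj D [set: Y] (L 1).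
Proof.
move=> c0 Lc Ld L0.
have d0 := normr_ge0 d.
pose N := (Num.truncn (`|d| / c)).+1.
have N0 : (0 : R) < N%:R by rewrite ltr0n.
have dN : `|d| / N%:R < c.
  by rewrite ltr_pdivrMr // mulrC -ltr_pdivrMr // truncnS_gt.
suff LN k : (k <= N)%N -> set_surj D [set: Y] (L (k%:R / N%:R)).
  by have := LN N (leqnn N); rewrite divff ?gt_eqF.
elim: k => [_|k IHk kN]; first by rewrite mul0r.
have {}IHk := IHk (ltnW kN).
set t : R := k%:R / N%:R in IHk *; set t' := k.+1%:R / N%:R.
have t'B : t' - t = N%:R^-1 by rewrite /t /t' -mulrBl -natrB // subSnn mul1r.
have t01 : 0 <= t <= 1.
  by rewrite divr_ge0 //= ler_pdivrMr // mul1r ler_nat ltnW.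
have := @expansion_perturb_surj R X Y D (L t) (fun x => L t' x - L t x) c
  (`|d| / N%:R).
rewrite divr_ge0 //= dN => /(_ isT (fun u v Du Dv => Lc t u v t01 Du Dv)).
move=> h y yT; have [u v Du Dv||x Dx xy] := h _ _ y yT.
- apply: le_trans (Ld _ _ _ _ Du Dv) _.
  rewrite t'B ger0_norm ?invr_ge0 // ler_wpM2r ?rnorm_ge0 //.
  by rewrite ler_wpM2r ?invr_ge0 // ler_norm.
- exact: IHk.
- by exists x => //; rewrite -xy addrC subrK.
Qed.

(** * Bounded maps and bounded invertibility in real norms *)

Lemma bounded_map_rnormP (R : realType) (X Y : hilbertType R) (f : X -> Y) :
  bounded_map f <->
  exists2 M : R, 0 <= M & forall x, rnorm (f x) <= M * rnorm x.
Proof.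
split=> [/bounded_ge0[M M0 fM]|[M M0 fM]]; last first.
  by exists M%:C%C => x; rewrite -!rnormE -rmorphM lecR.
have ME : M = (complex.Re M)%:C%C by rewrite RRe_real // ger0_real.
exists (complex.Re M) => [|x]; first by rewrite -(lecR 0) -ME.
by rewrite -lecR rmorphM /= -ME !rnormE.
Qed.

Lemma Re_inner_le (R : realType) (X : hilbertType R) (x y : X) :
  complex.Re '[x, y] <= rnorm x * rnorm y.
Proof.
have := cauchy_schwarz x y; rewrite -(rnormE x) -(rnormE y) -rmorphM /=.
rewrite normc_def lecR; apply: le_trans.
case: '[x, y] => a b /=; rewrite (le_trans (ler_norm a)) //.
by rewrite -sqrtr_sqr ler_wsqrtr // lerDl sqr_ge0.
Qed.

Lemma inner_rnorm (R : realType) (X : hilbertType R) (x : X) :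
  '[x, x] = (rnorm x ^+ 2)%:C%C.
Proof. by rewrite -norm_inner -rnormE rmorphXn. Qed.

Section OperatorLemmas.
Variables (R : realType) (X Y : hilbertType R) (T : operator X Y).

Lemma op_sub x y : dom T x -> dom T y -> T (x - y) = T x - T y.
Proof.
by move=> Tx Ty; rewrite addrC -scaleN1r op_lin // scaleN1r addrC.
Qed.

Lemma dom_sub x y : dom T x -> dom T y -> dom T (x - y).
Proof. by move=> Tx Ty; rewrite addrC -scaleN1r; exact: dom_lin. Qed.

Lemma inv_opK x : boundedly_invertible T -> dom T x -> inv_op T (T x) = x.
Proof.
by move=> [[_ Tinj _] _] Tx; rewrite /inv_op pinvKV // inE.
Qed.

Lemma op_invK y : boundedly_invertible T -> T (inv_op T y) = y.
Proof.
move=> Tb; have [[_ _ Tsurj] _] := Tb; have [x Tx <-] := Tsurj y I.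
by rewrite inv_opK.
Qed.

(** Separates surjectivity, which continuation carries over, from a lower bound, which the energy
    estimate supplies. The lower bound gives injectivity and the bound [c^-1] on the inverse. *)
Lemma boundedly_invertibleP : boundedly_invertible T <->
  set_surj (dom T) [set: Y] T /\
  exists2 c : R, 0 < c & forall x, dom T x -> c * rnorm x <= rnorm (T x).
Proof.
split=> [Tb|[Tsurj [c c0 Tc]]].
  have [[_ _ Tsurj] /bounded_map_rnormP[M M0 TM]] := Tb; split=> //.
  (* [M] may be zero, so [M + 1] is inverted. *)
  exists (M + 1)^-1 => [|x Tx]; first by rewrite invr_gt0 ltr_wpDl.
  rewrite mulrC ler_pdivrMr ?ltr_wpDl // mulrC mulrDl mul1r.
  by rewrite -{1}[x]inv_opK // (le_trans (TM _)) // lerDl rnorm_ge0.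
have Tinj : set_inj (dom T) T.
  move=> x y; rewrite !inE => Tx Ty Txy; apply/eqP; rewrite -subr_eq0.
  apply/eqP/rnorm0_eq0/le_anti; rewrite rnorm_ge0 andbT -(pmulr_rle0 _ c0).
  by rewrite (le_trans (Tc _ (dom_sub Tx Ty))) // op_sub // Txy subrr rnorm0.
have Tbij : set_bij (dom T) [set: Y] T by split.
split=> //; apply/bounded_map_rnormP; exists c^-1 => [|y].
  by rewrite invr_ge0 ltW.
have [x Tx <-] := Tsurj y I.
by rewrite /inv_op pinvKV ?inE // mulrC ler_pdivlMr // mulrC Tc.
Qed.

End OperatorLemmas.

(** * Energy estimate and uniform lower bounds *)

(** If the bound failed, [x] would exceed [2 * M * z], so [N * w] would be at least [x / 2];
    squaring and dividing by [x] gives a contradiction. In the application [w] is |E x|, controlled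
    by the geometric mean of [z] and [x]. *)
Lemma absorb_sqrt_term (R : realFieldType) (M N C x w z : R) :
  0 <= M -> 0 <= N -> 0 <= C -> 0 <= x -> 0 <= w -> 0 <= z ->
  x <= M * z + N * w -> w ^+ 2 <= C * (z * x) ->
  x <= (2 * M + 4 * N ^+ 2 * C) * z.
Proof.
move=> M0 N0 C0 x0 w0 z0 xMN wC; rewrite leNgt; apply/negP => xgt.
have NC : 0 <= 4 * N ^+ 2 * C * z by rewrite !mulr_ge0.
have Mz : 0 <= M * z by rewrite mulr_ge0.
have xp : 0 < x by apply: le_lt_trans xgt; rewrite mulrDl addr_ge0 // -mulrA mulr_ge0.
have h1 : x / 2 <= N * w by lra.
have h2 : (x / 2) ^+ 2 <= (N * w) ^+ 2 by rewrite ler_pXn2r ?nnegrE ?mulr_ge0 ?invr_ge0.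
have h3 : N ^+ 2 * w ^+ 2 <= N ^+ 2 * (C * (z * x)) by rewrite ler_wpM2l ?exprn_ge0.
have h4 : x * x <= x * (4 * N ^+ 2 * C * z).
  rewrite exprMn in h2; lra.
rewrite ler_pM2l // in h4; lra.
Qed.

Section Pencils.
Variables (R : realType) (H : hilbertType R) (A : operator H H).
Variables (E Q : bounded_operator H H).

(** The family L(a, b) as a bare map, used on the domain [D] of A Q. In particular [gen_pencil 0 l]
    is (l - A) Q and [gen_pencil 0 0] is - A Q. *)
Definition gen_pencil (a b : R[i]) (x : H) : H :=
  a *: E x + b *: Q x - A (Q x).

Let D : set H := dom (op_comp A Q).

Lemma gen_pencil_sub a b x y : D x -> D y ->
  gen_pencil a b (x - y) = gen_pencil a b x - gen_pencil a b y.
Proof.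
move=> Dx Dy; rewrite /gen_pencil !linearB /= op_sub //.
by rewrite (addrACA (a *: E x)) -opprD (opprD (A (Q x))) addrACA -opprD.
Qed.

(** In the difference of two members the unbounded term A Q cancels, leaving [t - s] times the
    bounded operator a1 E + b1 Q, whose bound [d] is the Lipschitz constant for continuation. *)
Lemma gen_pencil_continuation (a0 a1 b0 b1 : R[i]) (c : R) : 0 < c ->
  (forall (t : R) x, 0 <= t <= 1 -> D x ->
    c * rnorm x <=
      rnorm (gen_pencil (a0 + t%:C%C * a1) (b0 + t%:C%C * b1) x)) ->
  set_surj D [set: H] (gen_pencil a0 b0) ->
  set_surj D [set: H] (gen_pencil (a0 + a1) (b0 + b1)).
Proof.
move=> c0 Lc L0.
have /bounded_map_rnormP[d d0 dP] : bounded_map (fun x => a1 *: E x + b1 *: Q x).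
  have [M _ EM] := bounded_ge0 (bopP E); have [N _ QN] := bounded_ge0 (bopP Q).
  exists (`|a1| * M + `|b1| * N) => x; apply: (le_trans (ler_normD _ _)).
  by rewrite !normrZ mulrDl -!mulrA lerD // ler_wpM2l.
have := @expansion_continuation R H H D
  (fun t => gen_pencil (a0 + t%:C%C * a1) (b0 + t%:C%C * b1)) c d c0.
rewrite !mul0r !addr0 !mul1r; apply=> // [t u v t01 Du Dv|s t u v Du Dv].
  by rewrite -gen_pencil_sub // Lc //; exact: dom_sub.
have LB x : gen_pencil (a0 + t%:C%C * a1) (b0 + t%:C%C * b1) x -
    gen_pencil (a0 + s%:C%C * a1) (b0 + s%:C%C * b1) x =
    (t - s)%:C%C *: (a1 *: E x + b1 *: Q x).
  rewrite /gen_pencil opprB addrA subrK opprD addrACA -!scalerBl.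
  rewrite scalerDr !scalerA rmorphB /=; congr (_ *: _ + _ *: _); ring.
rewrite !LB -scalerBr opprD addrACA -!scalerBr -!linearB rnormZr /=.
by rewrite mulrC (mulrAC d) ler_wpM2r // dP.
Qed.

Hypothesis A_diss : dissipative A.
Variable k : R.
Hypothesis k0 : 0 < k.
Hypothesis kE : forall x, k%:C%C * `|E x| ^+ 2 <= '[E x, Q x].

Lemma energy_estimate (a : R[i]) (b : R) x : D x -> 0 <= complex.Re a ->
  complex.Re a * k * rnorm (E x) ^+ 2 + b * rnorm (Q x) ^+ 2 <=
  rnorm (gen_pencil a b%:C%C x) * rnorm (Q x).
Proof.
move=> Dx a0; apply: le_trans (Re_inner_le _ _).
rewrite /gen_pencil linearBl linearDl /= !linearZl_LR /= inner_rnorm.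
have := kE x; rewrite -rnormE -rmorphXn -rmorphM /=.
have := A_diss Dx; rewrite /=.
case: '[E x, Q x] => wr wi; case: '[A (Q x), Q x] => vr vi /=.
(* The order on R[i] compares only numbers with equal imaginary parts, so [kE] makes ['[E x, Q x]]
   real and the imaginary part of [a] drops out. *)
case: a a0 => ar ai /= a0 v0; rewrite lecE /= => /andP[/eqP -> kw].
have := ler_wpM2l a0 kw; rewrite mulrA; nra.
Qed.

Lemma gen_pencil_dist (a b a' b' : R[i]) x :
  rnorm (gen_pencil a b x) <= rnorm (gen_pencil a' b' x) +
    complex.Re `|a - a'| * rnorm (E x) + complex.Re `|b - b'| * rnorm (Q x).
Proof.
rewrite -!rnormZ -addrA.
apply: le_trans (lerD (lexx _) (ler_rnormD _ _)).
apply: le_trans (ler_rnormD _ _).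
rewrite [leLHS](_ : _ = rnorm (gen_pencil a' b' x +
  ((a - a') *: E x + (b - b') *: Q x))) //; congr rnorm.
by rewrite /gen_pencil !scalerBl [RHS]addrAC (addrACA (a' *: E x)) !subrKC.
Qed.

(** The first premise bounds |E x|^2 by (q / l) |L(a, b) x| |x|, with [q] a bound of [Q];
    [absorb_sqrt_term] then removes |E x| from the second. The constant depends on [l], [M], [N] and
    [q] only, hence is uniform in [a] and [b]. *)
Lemma gen_pencil_lower_bound (l M N : R) : 0 < l -> 0 <= M -> 0 <= N ->
  exists2 c : R, 0 < c & forall a b x,
    l * rnorm (E x) ^+ 2 <= rnorm (gen_pencil a b x) * rnorm (Q x) ->
    rnorm x <= M * rnorm (gen_pencil a b x) + N * rnorm (E x) ->
    c * rnorm x <= rnorm (gen_pencil a b x).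
Proof.
move=> l0 M0 N0; have /bounded_map_rnormP[q q0 Qq] := bopP Q.
pose K := 2 * M + 4 * N ^+ 2 * (q / l).
have ql : 0 <= q / l by exact: divr_ge0 (ltW l0).
have K0 : 0 <= K by rewrite addr_ge0 // !mulr_ge0 // invr_ge0 ltW.
exists (K + 1)^-1 => [|a b x h1 h2]; first by rewrite invr_gt0 ltr_wpDl.
rewrite mulrC ler_pdivrMr ?ltr_wpDl // mulrC.
set z := rnorm (gen_pencil _ _ _) in h1 h2 *.
have z0 : 0 <= z by exact: rnorm_ge0.
apply: (@le_trans _ _ (K * z)); last by rewrite ler_wpM2r // lerDl.
apply: (absorb_sqrt_term M0 N0 ql (rnorm_ge0 _) (rnorm_ge0 _) z0 h2).
rewrite mulrAC ler_pdivlMr // mulrC (le_trans h1) //.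
by rewrite mulrCA ler_wpM2l.
Qed.

(** * Transfer along the three segments *)

Lemma pencilE s x : pencil s E (op_comp A Q) x = gen_pencil s 0 x.
Proof. by rewrite /gen_pencil scale0r addr0. Qed.

(** Between [s0] and [s] the real part is at least the smaller of the two end values, so the energy
    estimate with [b = 0] holds with one constant [l]. *)
Lemma pencil_invertible_half_plane (s0 s : R[i]) :
  0 < complex.Re s0 -> 0 < complex.Re s ->
  boundedly_invertible (pencil s0 E (op_comp A Q)) ->
  boundedly_invertible (pencil s E (op_comp A Q)).
Proof.
move=> s00 s_0 /boundedly_invertibleP[surj0 [c c0 cP]].
pose l := Num.min (complex.Re s0) (complex.Re s) * k.
have l0 : 0 < l by rewrite mulr_gt0 // lt_min s00.
pose r := complex.Re `|s0 - s|.
have r0 : 0 <= r by rewrite /r normc_def sqrtr_ge0.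
have c0' : 0 <= c^-1 by rewrite invr_ge0 ltW.
have [d d0 dP] := @gen_pencil_lower_bound l c^-1 (c^-1 * r) l0 c0' (mulr_ge0 c0' r0).
have low (t : R) x : 0 <= t <= 1 -> D x ->
    d * rnorm x <= rnorm (gen_pencil (s0 + t%:C%C * (s - s0)) (0 + t%:C%C * 0) x).
  move=> /andP[t0 t1] Dx; rewrite mulr0 addr0; apply: dP.
    have Ret : Num.min (complex.Re s0) (complex.Re s) <=
        complex.Re (s0 + t%:C%C * (s - s0)).
      case: (s0) (s) => [ar ai] [br bi] /=.
      by rewrite mul0r subr0; have [h|h] := leP ar br; nra.
    have t_ge0 : 0 <= complex.Re (s0 + t%:C%C * (s - s0)).
      by apply: le_trans Ret; rewrite le_min !ltW.
    have := @energy_estimate (s0 + t%:C%C * (s - s0)) 0 x Dx t_ge0.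
    rewrite mul0r addr0; apply: le_trans.
    by rewrite ler_wpM2r ?exprn_ge0 ?rnorm_ge0 // /l ler_wpM2r // ltW.
  (* Moving from [s0] to the point at [t] costs at most [r] |E x|, which turns the lower bound [c]
     at [s0] into the second premise of [dP]. *)
  rewrite -mulrA -mulrDr mulrC ler_pdivlMr // mulrC.
  have := cP x Dx; rewrite pencilE => /le_trans; apply.
  have := gen_pencil_dist s0 0 (s0 + t%:C%C * (s - s0)) 0 x.
  rewrite subrr normr0 mul0r addr0 => /le_trans; apply.
  rewrite lerD2l ler_wpM2r ?rnorm_ge0 // /r -lecR !RRe_real ?ger0_real //.
  rewrite opprD addrA subrr sub0r normrN normrM (distrC s) ler_piMl //.
  by rewrite normc_def /= expr0n addr0 sqrtr_sqr lecR ger0_norm.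
apply/boundedly_invertibleP; split.
  have := @gen_pencil_continuation s0 (s - s0) 0 0 d d0 low.
  rewrite addr0 (addrC s0) subrK => h y _.
  have [|x Dx <-] := h _ y I; last by exists x => //; rewrite pencilE.
  by move=> z _; have [x Dx <-] := surj0 z I; exists x => //; rewrite pencilE.
exists d => // x Dx; rewrite pencilE.
have := low 1 x; rewrite lexx ler01 mul1r (addrC s0) subrK mulr0 addr0.
exact.
Qed.

Hypothesis Q_inv : boundedly_invertible (total_op Q).

(** The segment ends at L(0, l) = (l - A) Q; if this is surjective, so is l - A, with preimages of
    the form [Q x]. *)
Lemma pencil_max_dissipative (s0 : R[i]) :
  0 < complex.Re s0 -> boundedly_invertible (pencil s0 E (op_comp A Q)) ->
  max_dissipative A.
Proof.
move=> s00 /boundedly_invertibleP[surj0 [c c0 cP]]; split=> // l l0.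
have /boundedly_invertibleP[_ [q q0 /(_ _ I) qP]] := Q_inv.
have /bounded_map_rnormP[e e0 Ee] := bopP E.
pose r := complex.Re `|s0|.
have r0 : 0 <= r by rewrite /r normc_def sqrtr_ge0.
(* With [z] the norm of the member at [t], the energy estimate gives t l |Q x| <= z, hence t |E x|
   <= e / (l q) z. The distance from L(s0, 0) is also proportional to [t], so it costs at most (K -
   1) z even near t = 0, where control of |Q x| degenerates. *)
pose K := 2 + r * e / (l * q).
have K0 : 0 < K by rewrite ltr_pwDl // !mulr_ge0 // invr_ge0 mulr_ge0 // ltW.
have low (t : R) x : 0 <= t <= 1 -> D x -> c / K * rnorm x <=
    rnorm (gen_pencil (s0 + t%:C%C * - s0) (0 + t%:C%C * l%:C%C) x).
  move=> /andP[t0 t1] Dx; rewrite add0r -rmorphM.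
  set a := s0 + _; set z := rnorm (gen_pencil _ _ _).
  have tlQ : t * l * rnorm (Q x) <= z.
    have [Q0|Q0] := eqVneq (rnorm (Q x)) 0; first by rewrite Q0 mulr0 rnorm_ge0.
    have Qgt : 0 < rnorm (Q x) by rewrite lt_def Q0 rnorm_ge0.
    rewrite -(ler_pM2r Qgt) -(mulrA (t * l)) -expr2.
    have a0 : 0 <= complex.Re a.
      by rewrite /a; case: (s0) s00 => ar ai /= h; nra.
    apply: le_trans (@energy_estimate a (t * l) x Dx a0).
    by rewrite lerDr !mulr_ge0 ?exprn_ge0 ?rnorm_ge0 // ltW.
  rewrite mulrAC ler_pdivrMr //.
  have := cP x Dx; rewrite pencilE => /le_trans; apply.
  apply: le_trans (gen_pencil_dist s0 0 a (t * l)%:C%C x) _.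
  rewrite -/z; have -> : complex.Re `|s0 - a| = t * r.
    rewrite /a opprD addrA subrr sub0r mulrN opprK normrM.
    rewrite [ `|t%:C%C| ]ger0_norm ?(lecR 0) //.
    by rewrite -[ `|s0| ]RRe_real ?ger0_real // -rmorphM.
  have -> : complex.Re `|0 - (t * l)%:C%C| = t * l.
    by rewrite sub0r normrN [ `|_| ]ger0_norm ?(lecR 0) // mulr_ge0 // ltW.
  have lq : 0 < l * q by rewrite mulr_gt0.
  have : t * rnorm (E x) <= e / (l * q) * z.
    rewrite mulrAC ler_pdivlMr //.
    have h1 : t * rnorm (E x) * (l * q) <= t * (e * rnorm x) * (l * q).
      by rewrite ler_wpM2r ?(ltW lq) // ler_wpM2l.
    apply: (le_trans h1).
    have -> : t * (e * rnorm x) * (l * q) = e * (t * l * (q * rnorm x)) by ring.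
    rewrite ler_wpM2l //; apply: le_trans tlQ.
    by rewrite ler_wpM2l ?qP // mulr_ge0 // ltW.
  move=> /(ler_wpM2l r0) h.
  rewrite /K mulrDr -(mulrA r) (mulrC z 2) (mulrC z (r * _)).
  rewrite -!(mulrA r) in h *; lra.
have cK : 0 < c / K by rewrite divr_gt0.
have := gen_pencil_continuation cK low.
rewrite subrr add0r => h y _.
have [|x Dx <-] := h _ y I.
  by move=> z _; have [x Dx <-] := surj0 z I; exists x => //; rewrite pencilE.
by exists (Q x) => //; rewrite /gen_pencil scale0r add0r.
Qed.

(** The segment starts at L(0, 1) = (I - A) Q, surjective by maximality at s = 1, and ends at the
    pencil with s = 1. *)
Lemma max_dissipative_pencil_invertible (m : R) : max_dissipative A -> 0 < m ->
  (forall x, D x -> m * rnorm x <= rnorm (E x) + rnorm (A (Q x))) ->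
  boundedly_invertible (pencil 1 E (op_comp A Q)).
Proof.
move=> [_ A_max] m0 mP.
have /boundedly_invertibleP[Q_surj [q q0 /(_ _ I) qP]] := Q_inv.
have /bounded_map_rnormP[e e0 Ee] := bopP E.
have e1 : 0 < e + 1 by rewrite ltr_wpDl.
pose p := q / (e + 1); have p0 : 0 < p by rewrite divr_gt0.
have pP x : p * rnorm (E x) <= rnorm (Q x).
  apply: le_trans (qP x); rewrite /p mulrAC -mulrA ler_pM2l // ler_pdivrMr //.
  by rewrite (le_trans (Ee x)) // mulrC ler_wpM2l ?rnorm_ge0 // lerDl.
(* As |Q x| >= p |E x|, every convex combination of k |E x|^2 and |Q x|^2 is at least l |E x|^2. *)
pose l := Num.min k (p ^+ 2).
have l0 : 0 < l by rewrite lt_min k0 exprn_gt0.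
have m0' : 0 <= 2 / m by rewrite divr_ge0 // ltW.
(* Both constants come from m |x| <= |E x| + |A Q x| <= 2 z + 2 |E x|, the second step using (1 - t)
   |Q x| <= z. *)
have [d d0 dP] := @gen_pencil_lower_bound l (2 / m) (2 / m) l0 m0' m0'.
have low (t : R) x : 0 <= t <= 1 -> D x ->
    d * rnorm x <= rnorm (gen_pencil (0 + t%:C%C * 1) (1 + t%:C%C * - 1) x).
  move=> /andP[t0 t1] Dx.
  have -> : 0 + t%:C%C * 1 = t%:C%C :> R[i] by rewrite add0r mulr1.
  have -> : 1 + t%:C%C * - 1 = (1 - t)%:C%C :> R[i].
    by rewrite mulrN1 rmorphB.
  have t1' : 0 <= 1 - t by rewrite subr_ge0.
  have := @energy_estimate t%:C%C (1 - t) x Dx t0.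
  move: (dP t%:C%C (1 - t)%:C%C x); set z := rnorm (gen_pencil _ _ _).
  have z0 : 0 <= z by exact: rnorm_ge0.
  have Q0 := rnorm_ge0 (Q x); have E0 := rnorm_ge0 (E x).
  rewrite /= => dz en; apply: dz.
    apply: le_trans en.
    have lk : l * rnorm (E x) ^+ 2 <= k * rnorm (E x) ^+ 2.
      by rewrite ler_wpM2r ?exprn_ge0 // ge_min lexx.
    have lp : l * rnorm (E x) ^+ 2 <= rnorm (Q x) ^+ 2.
      apply: (@le_trans _ _ ((p * rnorm (E x)) ^+ 2)).
        by rewrite exprMn ler_wpM2r ?exprn_ge0 // ge_min lexx orbT.
      by rewrite ler_pXn2r ?nnegrE // (mulr_ge0 (ltW p0)).
    have := ler_wpM2l t0 lk; have := ler_wpM2l t1' lp; lra.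
  have tQ : (1 - t) * rnorm (Q x) <= z.
    have [->|Qn0] := eqVneq (rnorm (Q x)) 0; first by rewrite mulr0.
    have Qgt : 0 < rnorm (Q x) by rewrite lt_def Qn0.
    rewrite -(ler_pM2r Qgt) -mulrA -expr2; apply: le_trans en.
    by rewrite lerDr !mulr_ge0 ?exprn_ge0 // ltW.
  rewrite -mulrDr mulrAC ler_pdivlMr // mulrC.
  apply: (le_trans (mP x Dx)).
  have := gen_pencil_dist 0 0 t%:C%C (1 - t)%:C%C x.
  rewrite {1}/gen_pencil !scale0r add0r sub0r rnormN -/z !sub0r !normrN.
  rewrite ![ `|_%:C%C| ]ger0_norm ?(lecR 0) //= => h.
  have : t * rnorm (E x) <= rnorm (E x) by rewrite ler_piMl.
  lra.
apply/boundedly_invertibleP; split.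
  have := @gen_pencil_continuation 0 1 1 (- 1) d d0 low.
  rewrite add0r subrr => h y _.
  have [|x Dx <-] := h _ y I; last by exists x => //; rewrite pencilE.
  move=> z _; have [y' Dy <-] := A_max 1 ltr01 z I.
  have [x _ xy] := Q_surj y' I; rewrite /= in xy; exists x.
    by rewrite /D /= /preimage /= xy.
  by rewrite /gen_pencil scale0r add0r xy.
exists d => // x Dx; rewrite pencilE.
have := low 1 x; rewrite lexx ler01 !mul1r add0r subrr; exact.
Qed.

End Pencils.

(** * The cycle of implications *)

Theorem theorem13 (R : realType) (X1 X2 : hilbertType R)
    (A : operator (hsum X1 X2) (hsum X1 X2))
    (E1 Q1 : bounded_operator X1 X1) (Q2 : bounded_operator X2 X2) :
  dissipative A ->
  boundedly_invertible (total_op E1) ->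
  boundedly_invertible (total_op Q1) ->
  boundedly_invertible (total_op Q2) ->
  coercive (bop_comp (adjoint E1) Q1) ->
  let E := block_diag E1 (bop0 X2 X2) in
  let Q := block_diag Q1 Q2 in
  let AQ := op_comp A Q in
  [<-> regular E AQ;
       forall s : R[i], 0 < complex.Re s ->
         boundedly_invertible (pencil s E AQ);
       exists s : R[i], 0 < complex.Re s /\
         boundedly_invertible (pencil s E AQ);
       max_dissipative A /\
       exists m1 : R, 0 < m1 /\
         forall x : hsum X1 X2, dom A (Q x) ->
           m1%:C%C * `|x| <=
             `|((E x, A (Q x)) : hsum (hsum X1 X2) (hsum X1 X2))|;
       max_dissipative A /\
       exists m2 : R, 0 < m2 /\
         forall x : hsum X1 X2, dom A x ->
           m2%:C%C * `|x| <=
             `|((E (inv_op (total_op Q) x), A x)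
                 : hsum (hsum X1 X2) (hsum X1 X2))|].
Proof.
move=> A_diss E1_inv Q1_inv Q2_inv [_ [k1 k10 k1P]] E Q AQ.
have Q_inv : boundedly_invertible (total_op Q).
  have [Q1s [q1 q10 /(_ _ I) Q1P]] := (boundedly_invertibleP _).1 Q1_inv.
  have [Q2s [q2 q20 /(_ _ I) Q2P]] := (boundedly_invertibleP _).1 Q2_inv.
  apply/boundedly_invertibleP; split.
    move=> [y1 y2] _; have [x1 _ <-] := Q1s y1 I; have [x2 _ <-] := Q2s y2 I.
    by exists (x1, x2).
  exists (Num.min q1 q2) => [|x _]; first by rewrite lt_min q10.
  have q0 : 0 <= Num.min q1 q2 by rewrite le_min !ltW.
  rewrite -(ler_pXn2r (n := 2)) ?nnegrE ?mulr_ge0 ?rnorm_ge0 //.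
  rewrite exprMn -lecR rmorphM !rmorphXn /= !rnormE !hsum_normE !sqrtCK /=.
  rewrite mulrDr lerD // -!rnormE -!rmorphXn -rmorphM lecR -exprMn.
    rewrite ler_pXn2r ?nnegrE ?mulr_ge0 ?rnorm_ge0 //.
    by apply: le_trans (Q1P _); rewrite ler_wpM2r ?rnorm_ge0 // ge_min lexx.
  rewrite ler_pXn2r ?nnegrE ?mulr_ge0 ?rnorm_ge0 //.
  by apply: le_trans (Q2P _); rewrite ler_wpM2r ?rnorm_ge0 // ge_min lexx orbT.
have [k k0 kE] : exists2 k : R, 0 < k &
    forall x, k%:C%C * `|E x| ^+ 2 <= '[E x, Q x].
  have /bounded_map_rnormP[e e0 Ee] := bopP E1.
  have e1 : 0 < e + 1 by rewrite ltr_wpDl.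
  (* Coercivity bounds the inner product below by k1 |x.1|^2, and |E1 x.1| <= (e + 1) |x.1| converts
     this to |E x|^2. *)
  exists (k1 / (e + 1) ^+ 2) => [|x]; first by rewrite divr_gt0 ?exprn_gt0.
  have -> : '[E x, Q x] = '[E1 x.1, Q1 x.1] + '[(0 : X2), Q2 x.2] by [].
  rewrite linear0l addr0 hsum_normE sqrtCK /= normr0 expr0n addr0.
  have := k1P x.1; rewrite /= => h.
  (* Passing to the adjoint leaves a conjugate, harmless because coercivity makes the value a
     nonnegative real. *)
  have EQ : '[E1 x.1, Q1 x.1] = '[adjoint E1 (Q1 x.1), x.1].
    rewrite adjointP (hermC inner) expr0 mul1r; apply: geC0_conj.
    by apply: le_trans h; rewrite mulr_ge0 ?exprn_ge0 // (lecR 0) ltW.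
  rewrite EQ; apply: le_trans h.
  rewrite -!rnormE -!rmorphXn -!rmorphM lecR mulrAC ler_pdivrMr ?exprn_gt0 //.
  rewrite -mulrA ler_wpM2l ?(ltW k10) // -exprMn.
  rewrite ler_pXn2r ?nnegrE ?mulr_ge0 ?rnorm_ge0 ?(ltW e1) //.
  by rewrite (le_trans (Ee _)) // mulrC ler_wpM2l ?rnorm_ge0 // lerDl.
have [_ [q q0 /(_ _ I) qP]] := (boundedly_invertibleP _).1 Q_inv.
have /bounded_map_rnormP[M M0 QM] := bopP Q.
have M1 : 0 < M + 1 by rewrite ltr_wpDl.
tfae.
- move=> [s0 s00 inv0] s s_0.
  exact: (pencil_invertible_half_plane A_diss k0 kE s00 s_0 inv0).
- by move=> inv; exists 1; split; [exact: ltr01|apply: inv; exact: ltr01].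
- move=> [s [s0 s_inv]]; split.
    exact: (pencil_max_dissipative A_diss k0 kE Q_inv s0 s_inv).
  have [_ [c c0 cP]] := (boundedly_invertibleP _).1 s_inv.
  pose r := complex.Re `|s|.
  have r0 : 0 <= r by rewrite /r normc_def sqrtr_ge0.
  (* From c |x| <= |s E x - A Q x| <= r |E x| + |A Q x|, where both norms are at most that of the
     pair. *)
  exists (c / (r + 1)); have r1 : 0 < r + 1 by rewrite ltr_wpDl.
  split=> [|x Dx]; first by rewrite divr_gt0.
  rewrite ler_rnormM mulrAC ler_pdivrMr // (le_trans (cP _ Dx)) //.
  apply: (le_trans (ler_rnormB _ _)); rewrite rnormZ -/r.
  pose w : hsum (hsum X1 X2) (hsum X1 X2) := (E x, A (Q x)); rewrite -[(E x, _)]/w.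
  have Ew : rnorm (E x) <= rnorm w by rewrite -lecR !rnormE; exact: hsum_le_fst w.
  have Aw : rnorm (A (Q x)) <= rnorm w by rewrite -lecR !rnormE; exact: hsum_le_snd w.
  by rewrite mulrDr mulr1 lerD // mulrC ler_wpM2r.
- move=> [A_max [m1 [m10 m1P]]]; split=> //.
  (* The bound at the preimage of [y] under [Q] is rescaled by |y| <= (M + 1) |x|. *)
  exists (m1 / (M + 1)); split=> [|y Dy]; first by rewrite divr_gt0.
  have Qy : Q (inv_op (total_op Q) y) = y by exact: (op_invK y Q_inv).
  have := m1P (inv_op (total_op Q) y); rewrite Qy => /(_ Dy).
  rewrite !ler_rnormM; apply: le_trans.
  rewrite mulrAC ler_pdivrMr // -mulrA ler_wpM2l ?(ltW m10) //.
  rewrite -{1}Qy (le_trans (QM _)) // mulrC ler_wpM2l ?rnorm_ge0 //.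
  by rewrite lerDl.
(* Regularity is witnessed at s = 1; |Q x| >= q |x| turns [m2] into [m2 * q], and the norm of a pair
   is at most the sum of the norms. *)
- move=> [A_max [m2 [m20 m2P]]]; exists 1; first exact: ltr01.
  have m2q : 0 < m2 * q by rewrite mulr_gt0.
  apply: (max_dissipative_pencil_invertible A_diss k0 kE Q_inv A_max m2q) => x Dx.
  have := m2P (Q x) Dx.
  have -> : inv_op (total_op Q) (Q x) = x by exact: (inv_opK Q_inv I).
  rewrite ler_rnormM => h.
  apply: (@le_trans _ _ (m2 * rnorm (Q x))).
    by rewrite -mulrA ler_wpM2l ?(ltW m20) // qP.
  apply: (le_trans h); rewrite -lecR rmorphD /= !rnormE.
  exact: (hsum_le_add ((E x, A (Q x)) : hsum _ _)).
Qed.
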